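(* For each integer $h\ge0$, the lattice points of $\mathrm{cone}(T_{K_n})$ whose last coordinate equals $h$ are in bijection with the weak compositions of $hn$ of length $n$.
   Context: The Laplacian $L$ of a graph on $[n]$ has $L_{ii}=\deg(i)$, $L_{ij}=-1$ if $\{i,j\}$ is an edge and $0$ otherwise. Let $A$ be the $n\times(n-1)$ matrix with $a_{ij}=1$ if $i\le j\le n-1$ and $0$ otherwise; $L_B=LA$. The Laplacian simplex $T_G\subseteq\mathbb{R}^{n-1}$ is the convex hull of the rows of $L_B$; $K_n$ is the complete graph on $[n]$. For a polytope $P=\mathrm{conv}\{v_1,\dots,v_m\}\subseteq\mathbb{R}^{n-1}$, $\mathrm{cone}(P)\subseteq\mathbb{R}^n$ is the set of nonnegative combinations of the lifted points $(v_i,1)$. A weak composition of $N$ of length $n$ is a tuple $(c_1,\dots,c_n)$ of nonnegative integers with $\sum c_i=N$. *)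

(* Defs.v *)
From HB Require Import structures.
From mathcomp Require Import all_boot all_order all_algebra.
From mathcomp Require Import boolp classical_sets functions reals.

Set Implicit Arguments.
Unset Strict Implicit.
Unset Printing Implicit Defensive.

Import Order.TTheory GRing.Theory Num.Theory.

Local Open Scope classical_set_scope.
Local Open Scope ring_scope.

Record simple_graph (n : nat) := SimpleGraph {
  adj :> rel 'I_n;
  adj_sym : symmetric adj;
  adj_irrefl : irreflexive adj
}.

Section CompleteGraph.
Variable n : nat.

Let neq_rel : rel 'I_n := fun i j => i != j.

Let neq_rel_sym : symmetric neq_rel.
Proof. by move=> i j; rewrite /neq_rel eq_sym. Qed.

Let neq_rel_irrefl : irreflexive neq_rel.
Proof. by move=> i; rewrite /neq_rel eqxx. Qed.

Definition complete_graph : simple_graph n :=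
  SimpleGraph neq_rel_sym neq_rel_irrefl.

End CompleteGraph.

Section LaplacianSimplex.
Variable R : realType.

Definition degree n (G : simple_graph n) (i : 'I_n) : nat := #|[pred j | G i j]|.

Definition laplacian n (G : simple_graph n) : 'M[R]_n :=
  \matrix_(i, j) if i == j then (degree G i)%:R
                 else if G i j then -1 else 0.

(* Indices are 0-based, so the 1-based condition "i <= j <= n - 1" is again
   i <= j, with j ranging over 'I_n.-1. *)
Definition partial_sum_mx n : 'M[R]_(n, n.-1) :=
  \matrix_(i, j) if (i <= j)%N then 1 else 0.

Definition laplacian_B n (G : simple_graph n) : 'M[R]_(n, n.-1) :=
  laplacian G *m partial_sum_mx n.

Definition conv_rows m d (V : 'M[R]_(m, d)) : set 'rV[R]_d :=
  [set x | exists t : 'I_m -> R,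
     [/\ forall i, 0 <= t i,
         \sum_i t i = 1
       & x = \sum_i t i *: row i V]].

Definition laplacian_simplex n (G : simple_graph n) : set 'rV[R]_n.-1 :=
  conv_rows (laplacian_B G).

Definition lift_point d (v : 'rV[R]_d) : 'rV[R]_(d + 1) := row_mx v (const_mx 1).

Definition cone_rows m d (V : 'M[R]_(m, d)) : set 'rV[R]_(d + 1) :=
  [set y | exists t : 'I_m -> R,
     (forall i, 0 <= t i) /\ y = \sum_i t i *: lift_point (row i V)].

(* The cone is a function of the polytope alone: P may be presented by any
   finite list of points whose convex hull it is. The choice of presentation
   is immaterial by cone_conv_rows below. *)
Definition cone d (P : set 'rV[R]_d) : set 'rV[R]_(d + 1) :=
  [set y | exists m (V : 'M[R]_(m, d)), P = conv_rows V /\ cone_rows V y].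

Definition lattice_point d (y : 'rV[R]_d) : Prop :=
  forall j, y 0 j \is a Num.int.

Definition last_coord d (y : 'rV[R]_(d + 1)) : R := y 0 (rshift d ord0).

Lemma row_in_conv_rows m d (V : 'M[R]_(m, d)) i : conv_rows V (row i V).
Proof.
exists (fun k => (k == i)%:R); split.
- by move=> k; rewrite ler0n.
- by rewrite (bigD1 i) //= eqxx big1 ?addr0 // => k /negPf ->.
- rewrite (bigD1 i) //= eqxx scale1r big1 ?addr0 // => k /negPf ->.
  by rewrite scale0r.
Qed.

Lemma cone_rows_sub m p d (V : 'M[R]_(m, d)) (W : 'M[R]_(p, d)) :
  conv_rows V `<=` conv_rows W -> cone_rows V `<=` cone_rows W.
Proof.
move=> sVW y [t [t0 ->]].
have /choice[s sP] i : exists s : 'I_p -> R, [/\ forall k, 0 <= s k,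
    \sum_k s k = 1 & row i V = \sum_k s k *: row k W].
  by have := sVW _ (row_in_conv_rows V i).
exists (fun k => \sum_i t i * s i k); split.
  by move=> k; apply: sumr_ge0 => i _; apply: mulr_ge0 => //; case: (sP i).
transitivity (\sum_i \sum_k (t i * s i k) *: lift_point (row k W)).
  apply: eq_bigr => i _; have [_ s1 rE] := sP i.
  under eq_bigr do rewrite -scalerA.
  rewrite -scaler_sumr; congr (_ *: _).
  apply/rowP => j; rewrite summxE /lift_point rE.
  have [l ->|l ->] := split_ordP j.
    rewrite row_mxEl summxE; apply: eq_bigr => k _.
    by rewrite [LHS]mxE [RHS]mxE row_mxEl.
  rewrite row_mxEr mxE -[LHS]s1; apply: eq_bigr => k _.
  by rewrite [RHS]mxE row_mxEr [in RHS]mxE mulr1.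
rewrite exchange_big; apply: eq_bigr => k _.
by rewrite scaler_suml.
Qed.

Lemma cone_conv_rows m d (V : 'M[R]_(m, d)) : cone (conv_rows V) = cone_rows V.
Proof.
apply/seteqP; split => [y [p [W [VW]]]|y Vy]; last by exists m, V.
by apply: cone_rows_sub; rewrite VW.
Qed.

End LaplacianSimplex.

Arguments laplacian_simplex R {n} G.

Definition weak_compositions (N n : nat) : set (n.-tuple nat) :=
  [set c | (\sum_(i < n) tnth c i)%N = N].

Arguments weak_compositions N n : clear implicits.

(* Main.v *)
Require Import Defs.
From mathcomp Require Import all_boot all_order all_algebra.
From mathcomp Require Import classical_sets functions reals.
From mathcomp Require Import ring.
Import Order.TTheory GRing.Theory Num.Theory.
Local Open Scope classical_set_scope.
Local Open Scope ring_scope.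

(** With 0-based indices, the Laplacian of [K_n] is [n I - J], so row [i] of
    [L_B] has entries [n [i <= j] - (j + 1)].  The point of the cone with
    coefficients [t] therefore has coordinates
    [y_j = n (t_0 + ... + t_j) - (j + 1) y_last] with [y_last] the sum of the
    [t_i].  Put [y_(-1) = y_(n-1) = 0]; differencing gives
    [n t_i = y_i - y_(i-1) + y_last].  Hence [t] is determined by [y], the
    numbers [n t_i] are integers when [y] is a lattice point, and at height [h]
    they form a weak composition of [h n]; conversely every weak composition
    [c] arises from [t = c / n]. *)

Section CompleteGraphCone.
Variables (R : realType) (n : nat).
Implicit Types (t : 'I_n -> R) (y : 'rV[R]_(n.-1 + 1)) (c : n.-tuple nat).

Definition cone_comb t : 'rV[R]_(n.-1 + 1) :=
  \sum_i t i *: lift_point (row i (laplacian_B R (complete_graph n))).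

(* The coordinates of [y], shifted by one and padded with a zero at both ends:
   [padded y k] is [y_(k-1)] for [0 < k < n] and [0] otherwise. *)
Definition padded y (k : nat) : R :=
  if k is k'.+1 then
    if insub k' is Some j then y 0 (lshift 1 (j : 'I_n.-1)) else 0
  else 0.

Definition rescaled_coef y (i : 'I_n) : R :=
  padded y i.+1 - padded y i + last_coord y.

Lemma laplacian_complete (i j : 'I_n) :
  laplacian R (complete_graph n) i j = n%:R * (i == j)%:R - 1.
Proof.
rewrite mxE; have [->|nij] := eqVneq i j; last by rewrite /= nij mulr0 sub0r.
rewrite mulr1 /degree.
have -> : #|[pred k | complete_graph n j k]| = n.-1.
  rewrite -[in RHS](card_ord n) -(cardC1 j); apply: eq_card => k.
  by rewrite !inE eq_sym.
(* Since [j] inhabits ['I_n], n is positive and the truncated predecessor casts to n - 1. *)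
by rewrite -subn1 natrB // (leq_trans _ (ltn_ord j)).
Qed.

Lemma laplacian_B_complete (i : 'I_n) (j : 'I_n.-1) :
  laplacian_B R (complete_graph n) i j = n%:R * (i <= j)%N%:R - j.+1%:R.
Proof.
have jn : (j.+1 <= n)%N by rewrite (leq_trans (ltn_ord j)) // leq_pred.
rewrite mxE.
under eq_bigr => k _.
  rewrite laplacian_complete mxE mulrBl mul1r -mulrA.
  rewrite (_ : (if _ then 1 else 0) = (k <= j)%N%:R); last by case: ifP.
  over.
rewrite sumrB -mulr_sumr; congr (_ * _ - _).
  rewrite (bigD1 i) //= eqxx mul1r big1 ?addr0 // => k /negPf.
  by rewrite eq_sym => ->; rewrite mul0r.
(* The J part remains: column j of A has j + 1 ones, and [jn] keeps their indices inside ['I_n]. *)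
rewrite -natr_sum -big_mkcond /=; congr (_%:R).
rewrite (eq_bigl (fun k : 'I_n => (k < j.+1)%N)) //.
by rewrite -(big_ord_widen n (fun=> 1%N) jn) sum1_card card_ord.
Qed.

Lemma last_coord_cone_comb t : last_coord (cone_comb t) = \sum_i t i.
Proof.
rewrite /last_coord summxE; apply: eq_bigr => i _.
by rewrite mxE row_mxEr mxE mulr1.
Qed.

Lemma cone_comb_lshift t (j : 'I_n.-1) :
  cone_comb t 0 (lshift 1 j) =
  n%:R * \sum_(i < n | (i < j.+1)%N) t i - j.+1%:R * \sum_i t i.
Proof.
rewrite summxE [in RHS]big_mkcond /= !mulr_sumr -sumrB; apply: eq_bigr => i _.
rewrite mxE row_mxEl mxE laplacian_B_complete ltnS.
by case: leqP => _ /=; ring.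
Qed.

(** The padding zeros fit both ends: for k = 0 the sum is empty, and for k = n both sides are n
    times the last coordinate. *)
Lemma partial_sum_padded t (k : nat) : (k <= n)%N ->
  n%:R * \sum_(i < n | (i < k)%N) t i =
  padded (cone_comb t) k + k%:R * last_coord (cone_comb t).
Proof.
rewrite last_coord_cone_comb; case: k => [|k] kn.
  by rewrite big_pred0 //= mulr0 mul0r addr0.
rewrite /padded; case: insubP => [j _ <-|].
  by rewrite cone_comb_lshift subrK.
(* [insub] fails only from n - 1 on, so [kn] leaves just the upper end. *)
rewrite -leqNgt => nk; have <- : n = k.+1.
  by apply/eqP; rewrite eqn_leq kn andbT; case: (n) nk.
by rewrite add0r; congr (_ * _); apply: eq_bigl => i; rewrite ltn_ord.
Qed.

Lemma rescaled_coef_cone_comb t (i : 'I_n) :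
  rescaled_coef (cone_comb t) i = n%:R * t i.
Proof.
have -> : t i = \sum_(k < n | (k < i.+1)%N) t k - \sum_(k < n | (k < i)%N) t k.
  rewrite (bigD1 i) //= (eq_bigl (fun k : 'I_n => (k < i)%N)) ?addrK // => k.
  by rewrite ltnS [RHS]ltn_neqAle andbC.
rewrite mulrBr !partial_sum_padded //; last exact: ltnW.
by rewrite /rescaled_coef -natr1; ring.
Qed.

Lemma padded_int y k : lattice_point y -> padded y k \is a Num.int.
Proof. by move=> yZ; case: k => [|k] //=; case: insubP => // *; exact: yZ. Qed.

Lemma rescaled_coef_int y i : lattice_point y -> rescaled_coef y i \is a Num.int.
Proof. by move=> yZ; rewrite rpredD ?rpredB ?padded_int //; exact: yZ. Qed.

Lemma sum_rescaled_coef t :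
  \sum_i rescaled_coef (cone_comb t) i = n%:R * last_coord (cone_comb t).
Proof.
rewrite last_coord_cone_comb mulr_sumr.
by apply: eq_bigr => i _; rewrite rescaled_coef_cone_comb.
Qed.

Lemma cone_laplacian_complete y :
  cone (laplacian_simplex R (complete_graph n)) y <->
  exists2 t, (forall i, 0 <= t i) & y = cone_comb t.
Proof.
(* [cone] admits every presentation of the simplex; this fixes the one by the rows of L_B. *)
rewrite /laplacian_simplex cone_conv_rows.
by split=> [[t [t0 ->]]|[t t0 ->]]; exists t.
Qed.

(** On lattice points of the cone the truncation is exact, the rescaled coefficients being
    nonnegative integers there. *)
Definition composition_of y : n.-tuple nat :=
  [tuple Num.truncn (rescaled_coef y i) | i < n].

Definition point_of c : 'rV[R]_(n.-1 + 1) :=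
  cone_comb (fun i => (tnth c i)%:R / n%:R).

Hypothesis n_gt0 : (0 < n)%N.

Let n_neq0 : n%:R != 0 :> R.
Proof. by rewrite pnatr_eq0 -lt0n. Qed.

Lemma point_ofK c : composition_of (point_of c) = c.
Proof.
apply: eq_from_tnth => i.
by rewrite tnth_mktuple rescaled_coef_cone_comb mulrC divfK // natrK.
Qed.

Lemma tnth_composition_of t i :
  (forall j, 0 <= t j) -> lattice_point (cone_comb t) ->
  (tnth (composition_of (cone_comb t)) i)%:R = rescaled_coef (cone_comb t) i.
Proof.
move=> t0 yZ; rewrite tnth_mktuple; apply: truncnK.
by rewrite natrEint rescaled_coef_int //= rescaled_coef_cone_comb mulr_ge0.
Qed.

Lemma composition_ofK y :
  cone (laplacian_simplex R (complete_graph n)) y -> lattice_point y ->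
  point_of (composition_of y) = y.
Proof.
move=> /cone_laplacian_complete[t t0 ->] yZ.
(* Both sides combine the same lifted rows, so it suffices to compare coefficients. *)
apply: eq_bigr => i _; congr (_ *: _).
by rewrite tnth_composition_of // rescaled_coef_cone_comb mulrAC divff ?mul1r.
Qed.

Lemma point_of_lattice h c : weak_compositions (h * n) n c ->
  lattice_point (point_of c) /\ last_coord (point_of c) = h%:R.
Proof.
move=> cE; have sumE : \sum_i (tnth c i)%:R / n%:R = h%:R :> R.
  by rewrite -mulr_suml -natr_sum cE natrM mulfK.
split; last by rewrite last_coord_cone_comb.
move=> j; have [l ->|l ->] := split_ordP j.
  (* The factor n cancels the denominators, leaving a partial sum of [c] minus a multiple of [h]. *)
  rewrite cone_comb_lshift sumE -mulr_suml mulrC divfK //.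
  by rewrite -natr_sum -natrM rpredB ?rpred_nat.
by rewrite ord1 -[_ 0 _]/(last_coord _) last_coord_cone_comb sumE rpred_nat.
Qed.

End CompleteGraphCone.

Theorem theorem6p6 (R : realType) (n : nat) (hn : (0 < n)%N) (h : nat) :
  exists f : 'rV[R]_(n.-1 + 1) -> n.-tuple nat,
    set_bij
      [set y | [/\ cone (laplacian_simplex R (complete_graph n)) y,
                   lattice_point y
                 & last_coord y = h%:R]]
      (weak_compositions (h * n) n)
      f.
Proof.
exists (@composition_of R n); split.
- move=> y [/cone_laplacian_complete[t t0 ->] yZ yh].
  (* Casting to [R] turns the truncated entries back into rescaled coefficients, whose total is
     known. *)
  apply/eqP; rewrite -(eqr_nat R) natr_sum.
  under eq_bigr do rewrite tnth_composition_of //.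
  by rewrite sum_rescaled_coef yh natrM mulrC.
- move=> y z /set_mem[yC yZ _] /set_mem[zC zZ _] eqyz.
  by rewrite -(composition_ofK _ _ hn y) // eqyz composition_ofK.
- move=> c cE; exists (point_of R n c); last exact: point_ofK.
  have [cZ ch] := point_of_lattice R n hn h c cE; split=> //.
  apply/cone_laplacian_complete; eexists; last by [].
  by move=> i /=; rewrite divr_ge0.
Qed.
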